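(* The variety of all QB-algebras has the congruence extension property: for every QB-algebra $\mathbf{Q}$, every subalgebra $\mathbf{Q}_0$ of $\mathbf{Q}$ and every congruence $\theta_0$ on $\mathbf{Q}_0$, there exists a congruence $\theta$ on $\mathbf{Q}$ with $\theta_0=\theta\cap Q_0^{2}$.
   Context: A quasi-lattice is an algebra $\langle L;\vee,\wedge\rangle$ such that for all $x,y,z$: $\vee,\wedge$ are commutative and associative; $x\vee(x\wedge y)=x\vee x$ and $x\wedge(x\vee y)=x\wedge x$; $x\vee(y\vee y)=x\vee y$ and $x\wedge(y\wedge y)=x\wedge y$; $x\vee x=x\wedge x$. It is distributive if $x\vee(y\wedge z)=(x\vee y)\wedge(x\vee z)$ and $x\wedge(y\vee z)=(x\wedge y)\vee(x\wedge z)$. A quasi-Boolean algebra (QB-algebra) is an algebra $\langle Q;\vee,\wedge,{}^{*},0,1\rangle$ of type $\langle 2,2,1,0,0\rangle$ such that $\langle Q;\vee,\wedge\rangle$ is a distributive quasi-lattice and for all $x$: $x\vee 1=1$, $x\wedge 0=0$, $x\vee x^{*}=1$, $x\wedge x^{*}=0$, $(x\wedge x)^{*}=x^{*}\vee x^{*}$, $x^{**}=x$. *)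

(* Defs.v *)
From Stdlib Require Import Relation_Definitions RelationClasses.

Set Implicit Arguments.
Unset Strict Implicit.

(* Algebras of type <2,2,1,0,0>; no identity is imposed. *)
Record algebra : Type := Algebra {
  carrier :> Type;
  join : carrier -> carrier -> carrier;
  meet : carrier -> carrier -> carrier;
  star : carrier -> carrier;
  zero : carrier;
  one : carrier
}.

Arguments zero {a}.
Arguments one {a}.

Record quasi_lattice (L : Type) (j m : L -> L -> L) : Prop := QuasiLattice {
  ql_joinC : forall x y, j x y = j y x;
  ql_meetC : forall x y, m x y = m y x;
  ql_joinA : forall x y z, j x (j y z) = j (j x y) z;
  ql_meetA : forall x y z, m x (m y z) = m (m x y) z;
  ql_joinK : forall x y, j x (m x y) = j x x;
  ql_meetK : forall x y, m x (j x y) = m x x;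
  ql_joinJ : forall x y, j x (j y y) = j x y;
  ql_meetM : forall x y, m x (m y y) = m x y;
  ql_joinxx : forall x, j x x = m x x
}.

Record distributive_quasi_lattice (L : Type) (j m : L -> L -> L) : Prop :=
  DistributiveQuasiLattice {
  dql_quasi_lattice : quasi_lattice j m;
  dql_joinD : forall x y z, j x (m y z) = m (j x y) (j x z);
  dql_meetD : forall x y z, m x (j y z) = j (m x y) (m x z)
}.

Record QB_algebra (A : algebra) : Prop := QBAlgebra {
  qb_distributive_quasi_lattice : distributive_quasi_lattice (@join A) (@meet A);
  qb_join1 : forall x : A, join x one = one;
  qb_meet0 : forall x : A, meet x zero = zero;
  qb_joinN : forall x : A, join x (star x) = one;
  qb_meetN : forall x : A, meet x (star x) = zero;
  qb_starM : forall x : A, star (meet x x) = join (star x) (star x);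
  qb_starK : forall x : A, star (star x) = x
}.

Record subuniverse (A : algebra) : Type := Subuniverse {
  sub_mem :> A -> Prop;
  sub_join : forall x y, sub_mem x -> sub_mem y -> sub_mem (join x y);
  sub_meet : forall x y, sub_mem x -> sub_mem y -> sub_mem (meet x y);
  sub_star : forall x, sub_mem x -> sub_mem (star x);
  sub_zero : sub_mem zero;
  sub_one : sub_mem one
}.

Definition subalgebra (A : algebra) (S : subuniverse A) : algebra :=
  {| carrier := {x : A | S x};
     join := fun x y => exist _ (join (proj1_sig x) (proj1_sig y))
                              (sub_join (proj2_sig x) (proj2_sig y));
     meet := fun x y => exist _ (meet (proj1_sig x) (proj1_sig y))
                              (sub_meet (proj2_sig x) (proj2_sig y));
     star := fun x => exist _ (star (proj1_sig x)) (sub_star (proj2_sig x));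
     zero := exist _ zero (sub_zero S);
     one := exist _ one (sub_one S) |}.

Definition subalgebra_val (A : algebra) (S : subuniverse A)
  (x : subalgebra S) : A := proj1_sig x.

Record congruence (A : algebra) (R : relation A) : Prop := Congruence {
  cong_equiv : Equivalence R;
  cong_join : forall x x' y y', R x x' -> R y y' -> R (join x y) (join x' y');
  cong_meet : forall x x' y y', R x x' -> R y y' -> R (meet x y) (meet x' y');
  cong_star : forall x x', R x x' -> R (star x) (star x')
}.

(* Main.v *)
(** In a QB-algebra put [e x = x \/ x].  Joins and meets depend on their
    arguments only through [e] and take values in the Boolean algebra of regular
    elements ([e x = x]), and [e] commutes with the star; so outside the regular
    elements the star is the only operation that matters.  The elements of
    [Q0] congruent to [1] generate a filter, hence the Boolean congruence
    [x /\ f = y /\ f for some f in the filter], which is compatible with all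
    operations of [Q] but identifies [x] with [e x].  It is therefore only used
    on elements that are regular or already identified with [e x] by [theta0];
    elsewhere theta is [theta0] or equality. *)
Require Import Defs.
From Stdlib Require Import Relation_Definitions RelationClasses.
From Stdlib Require Import ProofIrrelevance.

(** * Computing with [e] and with complements under a fixed meet *)

Section Identities.

Context {Q : algebra}.
Hypothesis HQ : QB_algebra Q.

Let HD := qb_distributive_quasi_lattice HQ.
Let HL := dql_quasi_lattice HD.
Let joinC := ql_joinC HL.
Let meetC := ql_meetC HL.
Let meetA := ql_meetA HL.

Lemma join_regular (x y : Q) : join (join x y) (join x y) = join x y.
Proof.
  rewrite (ql_joinA HL), (joinC (join x y) x), (ql_joinA HL), <- (ql_joinA HL).
  rewrite (ql_joinJ HL), (joinC (join x x) y), (ql_joinJ HL).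
  apply joinC.
Qed.

Lemma meet_regular (x y : Q) : join (meet x y) (meet x y) = meet x y.
Proof.
  rewrite (ql_joinxx HL), meetA, (meetC (meet x y) x), meetA, <- meetA.
  rewrite (ql_meetM HL), (meetC (meet x x) y), (ql_meetM HL).
  apply meetC.
Qed.

Lemma star_square (x : Q) : join (star x) (star x) = star (join x x).
Proof. now rewrite (ql_joinxx HL x), (qb_starM HQ). Qed.

Lemma meet1 (x : Q) : meet x one = join x x.
Proof. now rewrite <- (qb_joinN HQ x), (ql_meetK HL), (ql_joinxx HL). Qed.

Lemma join0 (x : Q) : join x zero = join x x.
Proof. now rewrite <- (qb_meetN HQ x), (ql_joinK HL). Qed.

Lemma meet_squarel (x y : Q) : meet (join x x) y = meet x y.
Proof. now rewrite (ql_joinxx HL), meetC, (ql_meetM HL). Qed.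

Lemma meet_joinl (x y z : Q) :
  meet (join x y) z = join (meet x z) (meet y z).
Proof. now rewrite meetC, (dql_meetD HD), (meetC z x), (meetC z y). Qed.

(** Split [meet (star x) f] along [join y (star y) = one]: its meet with [y] equals
    [star x /\ x /\ f], which is zero. The result is symmetric in [x] and [y] once both lie over the
    same meet with [f]. *)
Lemma meet_starl (x y f : Q) :
  meet x f = meet y f -> meet (star x) f = meet (meet (star x) f) (star y).
Proof.
  intros E.
  assert (Z : meet (meet (star x) f) y = zero).
  { rewrite <- meetA, (meetC f y), <- E, meetA, (meetC (star x) x).
    rewrite (qb_meetN HQ), meetC. apply (qb_meet0 HQ). }
  transitivity (meet (meet (star x) f) (join y (star y))).
  { now rewrite (qb_joinN HQ), meet1, meet_regular. }
  rewrite (dql_meetD HD), Z.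
  rewrite joinC, join0. apply meet_regular.
Qed.

Lemma meet_star_congr (x y f : Q) :
  meet x f = meet y f -> meet (star x) f = meet (star y) f.
Proof.
  intros E. rewrite (meet_starl _ _ _ E), (meet_starl _ _ _ (eq_sym E)).
  now rewrite <- !meetA, (meetC f), (meetC f), !meetA, (meetC (star x)).
Qed.

(** The second argument is the Boolean biconditional of [x] and [y]; after distributing, the term
    with [x /\ star x] vanishes. As the biconditional is symmetric, [x] and [y] have the same meet
    with it. *)
Lemma meet_biconditional (x y : Q) :
  meet x (join (meet x y) (meet (star x) (star y))) = meet x y.
Proof.
  rewrite (dql_meetD HD), !meetA, (qb_meetN HQ), (meetC zero).
  rewrite (qb_meet0 HQ), join0, meet_regular, <- (ql_joinxx HL).
  apply meet_squarel.
Qed.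

End Identities.

Section Extension.

Context {Q : algebra}.
Hypothesis HQ : QB_algebra Q.

(* [T] is theta0 viewed as a partial congruence of [Q]; its domain
   [{x | T x x}] is the subuniverse. *)
Variable T : relation Q.
Hypothesis T_sym : forall x y, T x y -> T y x.
Hypothesis T_trans : forall x y z, T x y -> T y z -> T x z.
Hypothesis T_join : forall x x' y y',
  T x x' -> T y y' -> T (join x y) (join x' y').
Hypothesis T_meet : forall x x' y y',
  T x x' -> T y y' -> T (meet x y) (meet x' y').
Hypothesis T_star : forall x x', T x x' -> T (star x) (star x').
Hypothesis T_one : T one one.

Let HD := qb_distributive_quasi_lattice HQ.
Let HL := dql_quasi_lattice HD.
Let joinC := ql_joinC HL.
Let meetC := ql_meetC HL.
Let meetA := ql_meetA HL.

(** * The congruence of the filter generated by the class of [one] *)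

Definition filter_rel : relation Q := fun x y =>
  exists f, T f one /\ meet x f = meet y f.

Lemma filter_rel_refl x : filter_rel x x.
Proof. now exists one. Qed.

Lemma filter_rel_sym x y : filter_rel x y -> filter_rel y x.
Proof. intros [f [Tf E]]. now exists f. Qed.

Lemma T_one_meet f g : T f one -> T g one -> T (meet f g) one.
Proof.
  intros Tf Tg. generalize (T_meet _ _ _ _ Tf Tg).
  now rewrite (meet1 HQ), (qb_join1 HQ).
Qed.

(** The class of [one] is closed under meets, so the meet of the two witnesses serves both pairs. *)
Lemma filter_rel_common x y x' y' :
  filter_rel x y -> filter_rel x' y' ->
  exists f, T f one /\ meet x f = meet y f /\ meet x' f = meet y' f.
Proof.
  intros [f [Tf E]] [g [Tg E']]. exists (meet f g).
  split; [now apply T_one_meet|split].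
  - now rewrite !meetA, E.
  - now rewrite (meetC f g), !meetA, E'.
Qed.

Lemma filter_rel_trans x y z :
  filter_rel x y -> filter_rel y z -> filter_rel x z.
Proof.
  intros H K. destruct (filter_rel_common _ _ _ _ H K) as [f [Tf [E E']]].
  exists f. now rewrite E.
Qed.

Lemma filter_rel_join x x' y y' :
  filter_rel x x' -> filter_rel y y' -> filter_rel (join x y) (join x' y').
Proof.
  intros H K. destruct (filter_rel_common _ _ _ _ H K) as [f [Tf [E E']]].
  exists f. now rewrite !(meet_joinl HQ), E, E'.
Qed.

Lemma filter_rel_meet x x' y y' :
  filter_rel x x' -> filter_rel y y' -> filter_rel (meet x y) (meet x' y').
Proof.
  intros H K. destruct (filter_rel_common _ _ _ _ H K) as [f [Tf [E E']]].
  exists f. split; [easy|].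
  now rewrite <- meetA, E', meetA, (meetC x), <- meetA, E, meetA, (meetC y').
Qed.

Lemma filter_rel_star x x' :
  filter_rel x x' -> filter_rel (star x) (star x').
Proof.
  intros [f [Tf E]]. exists f. split; [easy|now apply (meet_star_congr HQ)].
Qed.

Lemma T_filter_rel x y : T x y -> filter_rel x y.
Proof.
  intros H. assert (Hx : T x x) by eauto.
  (* The biconditional is the witness: modulo [T], [y] may be replaced by [x], and then it becomes
     [x \/ star x = one], up to squares that joins absorb. *)
  exists (join (meet x y) (meet (star x) (star y))). split.
  - assert (K : T (join (meet x y) (meet (star x) (star y)))
                  (join (meet x x) (meet (star x) (star x)))) by auto.
    enough (E : join (meet x x) (meet (star x) (star x)) = one)
      by now rewrite E in K.
    rewrite <- !(ql_joinxx HL), (ql_joinJ HL), joinC, (ql_joinJ HL), joinC.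
    apply (qb_joinN HQ).
  - rewrite (meet_biconditional HQ), (meetC x y), (meetC (star x)).
    now rewrite (meet_biconditional HQ).
Qed.

(** Modulo [T], meeting with [f] is meeting with [one], which yields [e x]. Hence [e x],
    [x /\ f = y /\ f] and [e y] form a chain. *)
Lemma filter_rel_T x y :
  T x x -> T y y -> filter_rel x y -> T (join x x) (join y y).
Proof.
  intros Hx Hy [f [Tf E]]. rewrite <- !(meet1 HQ).
  apply T_trans with (meet x f); [|rewrite E]; auto.
Qed.

(** * Gluing [T], equality and the filter congruence *)

Definition collapsed (x : Q) : Prop := join x x = x \/ T x (join x x).

Lemma collapsed_T x y : T x y -> collapsed y -> collapsed x.
Proof.
  intros H C. right.
  assert (K : T y (join y y)).
  { destruct C as [->|C]; [|easy]. eauto. }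
  apply T_trans with y; [easy|]. apply T_trans with (join y y); auto.
Qed.

Lemma collapsed_star x : collapsed x -> collapsed (star x).
Proof.
  unfold collapsed. rewrite (star_square HQ).
  intros [C|C]; [left; now rewrite C|right; auto].
Qed.

Definition extension : relation Q := fun x y =>
  x = y \/ T x y \/ (collapsed x /\ collapsed y /\ filter_rel x y).

Lemma extension_filter_rel x y : extension x y -> filter_rel x y.
Proof.
  intros [->|[H|[_ [_ H]]]]; [apply filter_rel_refl|now apply T_filter_rel|easy].
Qed.

Lemma extension_sym x y : extension x y -> extension y x.
Proof.
  intros [->|[H|[? [? H]]]]; [now left|right; left; auto|].
  right; right. auto using filter_rel_sym.
Qed.

Lemma extension_collapsed x y : extension x y -> collapsed y -> collapsed x.
Proof.
  intros [->|[H|[C _]]] Cy; [easy|now apply (collapsed_T _ _ H)|easy].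
Qed.

(** Every disjunct implies [filter_rel], which is transitive; in the mixed cases it remains to see
    that being collapsed passes along [extension]. *)
Lemma extension_trans x y z : extension x y -> extension y z -> extension x z.
Proof.
  intros H K.
  assert (F : filter_rel x z)
    by eauto using filter_rel_trans, extension_filter_rel.
  destruct (H) as [->|[Txy|[Cx [Cy _]]]]; [easy| |].
  - destruct (K) as [<-|[Tyz|[Cy [Cz _]]]]; [easy|right; left; eauto|].
    right; right. eauto using collapsed_T.
  - right; right. eauto using extension_collapsed, extension_sym.
Qed.

Lemma extension_congruence : congruence extension.
Proof.
  split.
  - split; red; [now left|exact extension_sym|exact extension_trans].
  (* Joins are regular, hence collapsed, so the third disjunct holds whichever disjuncts relate the
     arguments. *)
  - intros x x' y y' H K. right; right.
    split; [|split]; [left; apply (join_regular HQ)..|].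
    auto using filter_rel_join, extension_filter_rel.
  - intros x x' y y' H K. right; right.
    split; [|split]; [left; apply (meet_regular HQ)..|].
    auto using filter_rel_meet, extension_filter_rel.
  - intros x x' [->|[H|[C [C' H]]]]; [now left|right; left; auto|].
    right; right. auto using collapsed_star, filter_rel_star.
Qed.

Lemma collapsed_square x : T x x -> collapsed x -> T x (join x x).
Proof. intros H [->|C]; easy. Qed.

Lemma extension_restrict x y : T x x -> T y y -> extension x y -> T x y.
Proof.
  intros Hx Hy [->|[H|[Cx [Cy F]]]]; [easy..|].
  (* The chain is [x], [e x], [e y], [y]; being collapsed supplies its two outer links. *)
  apply T_trans with (join x x); [now apply collapsed_square|].
  apply T_trans with (join y y); [now apply filter_rel_T|].
  now apply T_sym, collapsed_square.
Qed.

End Extension.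

(** * Transfer between a congruence of the subalgebra and its image in [Q] *)

Theorem theorem5p6 :
  forall (Q : algebra), QB_algebra Q ->
  forall (Q0 : subuniverse Q) (theta0 : relation (subalgebra Q0)),
    congruence theta0 ->
    exists theta : relation Q,
      congruence theta /\
      (forall x y : subalgebra Q0,
         theta0 x y <-> theta (subalgebra_val x) (subalgebra_val y)).
Proof.
  intros Q HQ Q0 theta0 [[R S Tr] CJ CM CS].
  set (T := fun a b : Q => exists x y : subalgebra Q0,
    theta0 x y /\ subalgebra_val x = a /\ subalgebra_val y = b).
  assert (T_val : forall x y : subalgebra Q0,
    T (subalgebra_val x) (subalgebra_val y) -> theta0 x y).
  { intros x y [u [v [H [Eu Ev]]]].
    (* By proof irrelevance, elements of the subalgebra with equal values are equal, so [T] pulls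
       back to exactly [theta0]. *)
    apply (subset_eq_compat _ _ _ _ (proj2_sig u) (proj2_sig x)) in Eu.
    apply (subset_eq_compat _ _ _ _ (proj2_sig v) (proj2_sig y)) in Ev.
    destruct u, v, x, y; simpl in *. now rewrite <- Eu, <- Ev. }
  assert (val_T : forall x y : subalgebra Q0,
    theta0 x y -> T (subalgebra_val x) (subalgebra_val y)).
  { intros x y H. now exists x, y. }
  assert (T_sym : forall a b, T a b -> T b a).
  { intros a b [x [y [H [<- <-]]]]. auto. }
  assert (T_trans : forall a b c, T a b -> T b c -> T a c).
  { intros a b c [x [y [H [<- <-]]]] [y' [z [K [E <-]]]].
    (* [y] and [y'] share a value but may carry different membership proofs; [T_val] bridges
       them. *)
    apply val_T, Tr with y; [easy|]. apply T_val. rewrite <- E. auto. }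
  assert (T_join : forall a a' b b',
    T a a' -> T b b' -> T (join a b) (join a' b')).
  { intros a a' b b' [x [x' [H [<- <-]]]] [y [y' [K [<- <-]]]].
    exact (val_T _ _ (CJ _ _ _ _ H K)). }
  assert (T_meet : forall a a' b b',
    T a a' -> T b b' -> T (meet a b) (meet a' b')).
  { intros a a' b b' [x [x' [H [<- <-]]]] [y [y' [K [<- <-]]]].
    exact (val_T _ _ (CM _ _ _ _ H K)). }
  assert (T_star : forall a a', T a a' -> T (star a) (star a')).
  { intros a a' [x [x' [H [<- <-]]]]. exact (val_T _ _ (CS _ _ H)). }
  assert (T_one : T one one) by exact (val_T _ _ (R (@one (subalgebra Q0)))).
  exists (extension T). split.
  - now apply extension_congruence.
  - intros x y; split; intros H.
    + right; left. auto.
    + apply T_val, extension_restrict; auto.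
Qed.
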